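(* Let $m\in\mathbb{N}$ have $r\ge2$ distinct prime factors. Fix $h\in\mathbb{N}$ and functions $k_1,\dots,k_h\colon\mathbb{N}\to\mathbb{N}$ with $\prod_{i\in[h]}k_i(n)=n$ for all $n$, and let $k_{\max}(n)=\max_i k_i(n)$. For every $n\in\mathbb{N}$ there is an $\mathbf{Aut}(\mathcal{T}_n^{\boldsymbol{k}})$-symmetric $\mathrm{MOD}_m$-circuit $C_n$ of depth $2h$ and size $2^{O(k_{\max}(n)^{1/r}\cdot\log k_{\max}(n))}$ that computes $\mathrm{AND}_n$.
   Context: $\mathrm{MOD}_m^R$ ($R\subseteq\mathbb{Z}_m$) outputs $1$ on Boolean inputs iff their sum mod $m$ lies in $R$. A $\mathrm{MOD}_m$-circuit on $x_1,\dots,x_n$ is a finite DAG with multiwires, one output gate, one input gate per variable, other gates labelled by some $\mathrm{MOD}_m^R$ and evaluated on children's values with wire multiplicity. Size = gates plus wires (with multiplicity); depth = maximum number of wires on an output-to-input path. $\mathcal{T}_n^{\boldsymbol{k}}$ is the rooted tree with levels $0,\dots,h$ (root on level $h$), each node on level $i\in[h]$ having $k_i(n)$ children, leaves identified with $[n]$; $\mathbf{Aut}(\mathcal{T}_n^{\boldsymbol{k}})\le\mathbf{Sym}_n$ via its action on leaves. For $\Gamma\le\mathbf{Sym}_n$, a circuit is $\Gamma$-symmetric if every $\pi\in\Gamma$ extends to a circuit automorphism (preserving gate labels and wire multiplicities) mapping the input gate of $x_i$ to that of $x_{\pi(i)}$. *)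

(* Defs.v *)
From HB Require Import structures.
From mathcomp Require Import all_boot all_order all_fingroup all_algebra.
From mathcomp Require Import all_classical all_reals all_analysis.

Set Implicit Arguments.
Unset Strict Implicit.
Unset Printing Implicit Defensive.

(* [wires g g'] is the multiplicity of the wire by which the gate [g] reads the
   child [g'], so that paths run from the output towards the inputs.
   The label [inl i] marks the input gate of the variable x_i, and [inr R] marks
   a MOD_m^R gate.  Residues live in 'Z_m, which is the ring of integers mod m
   only for 1 < m. *)
Record circuit (m n : nat) := Circuit {
  gate :> finType;
  label : gate -> 'I_n + {set 'Z_m};
  wires : gate -> gate -> nat;
  input : 'I_n -> gate;
  output : gate;
  label_input : forall g i, label g = inl i <-> g = input i;
  wires_input : forall i g, wires (input i) g = 0;
  wires_acyclic : forall g g', 0 < wires g g' ->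
    ~~ connect (fun a b => 0 < wires a b) g' g }.

Definition MOD_gate (m : nat) (R : {set 'Z_m}) (s : nat) : bool :=
  (s%:R)%R \in R.

Section Circuits.
Variables (m n : nat) (C : circuit m n).

Definition child : rel C := fun g g' => 0 < wires g g'.

Definition gate_value (x : {ffun 'I_n -> bool}) (v : C -> bool) (g : C) : bool :=
  match label g with
  | inl i => x i
  | inr R => MOD_gate R (\sum_(g' : C) wires g g' * v g')
  end.

(* Iterating the local rule #|C| times from an arbitrary initial assignment
   reaches the unique consistent one (lemma [evalE]), since the wires are
   acyclic. *)
Definition eval (x : {ffun 'I_n -> bool}) : C -> bool :=
  iter #|C| (gate_value x) (fun=> false).

Definition computes (f : {ffun 'I_n -> bool} -> bool) : Prop :=
  forall x, eval x (output C) = f x.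

Definition circuit_size : nat := #|C| + \sum_(g : C) \sum_(g' : C) wires g g'.

Definition io_path (p : seq C) : Prop :=
  path child (output C) p /\ exists i, last (output C) p = input C i.

Definition has_depth (d : nat) : Prop :=
  (exists2 p, io_path p & size p = d) /\ (forall p, io_path p -> size p <= d).

Definition relabel (s : 'S_n) (l : 'I_n + {set 'Z_m}) : 'I_n + {set 'Z_m} :=
  match l with inl i => inl (s i) | inr R => inr R end.

Definition circuit_aut_extends (s : 'S_n) (t : {perm C}) : Prop :=
  [/\ forall g, label (t g) = relabel s (label g),
      forall g g', wires (t g) (t g') = wires g g' &
      t (output C) = output C].

Definition symmetric_circuit (G : {group 'S_n}) : Prop :=
  forall s, s \in G -> exists t : {perm C}, circuit_aut_extends s t.

Lemma gate_value_local x v w g :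
  (forall g', child g g' -> v g' = w g') -> gate_value x v g = gate_value x w g.
Proof.
move=> vw; rewrite /gate_value; case: (label g) => // R; congr (MOD_gate R _).
apply: eq_bigr => g' _; case: (posnP (wires g g')) => [-> //|gg'].
by rewrite vw.
Qed.

Definition below (g : C) : nat := #|[set g' | connect child g g']|.

Lemma below_child g g' : child g g' -> below g' < below g.
Proof.
move=> gg'; apply: proper_card; apply/properP; split.
  apply/fintype.subsetP => a; rewrite !inE => g'a.
  exact: connect_trans (connect1 gg') g'a.
by exists g; rewrite inE ?connect0 //; apply: wires_acyclic.
Qed.

Lemma iter_gate_value x v j g : below g <= j ->
  iter j.+1 (gate_value x) v g = iter j (gate_value x) v g.
Proof.
elim: j g => [|j IH] g gj.
  by move: gj; rewrite leqNgt card_gt0; case/negP; apply/set0Pn; exists g; rewrite inE.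
apply: (@gate_value_local _ (iter j.+1 _ v) (iter j _ v)) => g' /below_child lt.
by apply: IH; rewrite -ltnS; apply: leq_trans lt gj.
Qed.

Lemma evalE x g : eval x g = gate_value x (eval x) g.
Proof. by rewrite /eval -iterS iter_gate_value //; apply: max_card. Qed.

Lemma eval_unique x v : (forall g, v g = gate_value x v g) -> v =1 eval x.
Proof.
move=> vE g; have [j] := ubnP (below g); elim: j g => // j IH g gj.
rewrite vE evalE; apply: gate_value_local => g' /below_child lt.
by apply: IH; apply: leq_trans lt _; rewrite -ltnS.
Qed.

End Circuits.

Definition AND_fun (n : nat) (x : {ffun 'I_n -> bool}) : bool := [forall i, x i].

(* The index i : 'I_h of the branching numbers stands for the level i.+1. *)
Record level_tree (n h : nat) (k : 'I_h -> nat) := LevelTree {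
  node :> finType;
  root : node;
  parent : node -> option node;
  level : node -> 'I_h.+1;
  leaf : 'I_n -> node;
  parent_root : forall v, parent v = None <-> v = root;
  level_root : forall v, level v = ord_max <-> v = root;
  level_parent : forall u v, parent u = Some v -> level v = (level u).+1 :> nat;
  card_children : forall v (i : 'I_h), level v = i.+1 :> nat ->
    #|[set u | parent u == Some v]| = k i;
  leaf_inj : injective leaf;
  level_leaf : forall v, level v = 0 :> nat <-> exists j, v = leaf j }.

Section Trees.
Variables (n h : nat) (k : 'I_h -> nat) (T : level_tree n k).

Definition tree_aut (t : {perm T}) : bool :=
  [forall u, parent (t u) == omap t (parent u)].

Definition Aut_leaves_set : {set 'S_n} :=
  [set s : 'S_n | [exists t : {perm T},
     tree_aut t && [forall j, t (leaf T j) == leaf T (s j)]]].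

Lemma Aut_leaves_group_set : group_set Aut_leaves_set.
Proof.
apply/group_setP; split.
  rewrite inE; apply/existsP; exists 1%g; apply/andP; split.
    apply/forallP => u; rewrite perm1; case: (parent u) => //= v.
    by rewrite perm1.
  by apply/forallP => j; rewrite !perm1.
move=> s s'; rewrite !inE => /existsP[t /andP[/forallP tA /forallP tL]].
move=> /existsP[t' /andP[/forallP tA' /forallP tL']].
apply/existsP; exists (t * t')%g; apply/andP; split; apply/forallP => u.
  rewrite permM (eqP (tA' _)) (eqP (tA _)); case: (parent u) => //= v.
  by rewrite permM.
by rewrite !permM (eqP (tL _)) (eqP (tL' _)).
Qed.

Definition Aut_leaves : {group 'S_n} := Group Aut_leaves_group_set.

End Trees.

Lemma level_tree_exists (n h : nat) (k : 'I_h -> nat) :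
  \prod_(i < h) k i = n -> inhabited (level_tree n k).
Proof.
elim: h n k => [|h IH] n k.
  rewrite big_ord0 => <-; constructor.
  unshelve refine (@LevelTree 1 0 k unit tt (fun=> None) (fun=> ord0)
    (fun=> tt) _ _ _ _ _ _).
  - by case.
  - by case; split=> // _; apply/val_inj.
  - by [].
  - by move=> v [].
  - by move=> i j _; rewrite !ord1.
  - by case; split=> // _; exists ord0.
rewrite big_ord_recr /= => prodE.
have [T] := IH _ _ (erefl (\prod_(i < h) k (widen_ord (leqnSn h) i))).
set p := \prod_(i < h) _ in prodE T.
have cardE : #|{: 'I_(k ord_max) * 'I_p}| = n by rewrite card_prod !card_ord mulnC.
pose code (j : 'I_n) : 'I_(k ord_max) * 'I_p := enum_val (cast_ord (esym cardE) j).
have codeK q : exists j, q = code j.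
  by exists (cast_ord cardE (enum_rank q)); rewrite /code cast_ordK enum_rankK.
have code_inj : injective code by move=> i j /enum_val_inj /cast_ord_inj.
pose N := option ('I_(k ord_max) * T)%type.
pose par (u : N) : option N :=
  if u is Some (c, u') then
    Some (if parent u' is Some v then Some (c, v) else None) else None.
pose lev (u : N) : 'I_h.+2 :=
  if u is Some (c, u') then widen_ord (leqnSn _) (level u') else ord_max.
constructor.
unshelve refine (@LevelTree n h.+1 k N None par lev
  (fun j => Some ((code j).1, leaf T (code j).2)) _ _ _ _ _ _).
- by case=> [[c u]|].
- case=> [[c u]|]; split=> // /(congr1 val) /= E.
  by have := ltn_ord (level u); rewrite E ltnn.
- case=> [[c u]|] // v [<-] /=; case E: (parent u) => [w|] /=.
    exact: level_parent E.
  by move/parent_root: E => /level_root ->.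
- case=> [[c u]|] i /= lE.
    have ih : i < h by rewrite -ltnS -lE.
    have := @card_children _ _ _ T u (Ordinal ih) lE.
    rewrite (_ : widen_ord _ _ = i); last exact/val_inj.
    move=> <-; rewrite -(card_imset _ (_ : injective (fun u' : T => Some (c, u') : N)));
      last by move=> a b [].
    apply: eq_card => -[[c' u']|]; last first.
      by rewrite inE /=; apply/esym/imsetP => -[].
    rewrite inE /=; apply/eqP/imsetP.
      case E: (parent u') => [w|] // [<- wu]; exists u' => //.
      by rewrite inE E wu.
    by move=> [w]; rewrite inE => /eqP E [-> ->]; rewrite E.
  have -> : i = ord_max by apply/val_inj; case: lE => /= E; rewrite -E.
  rewrite -[RHS]card_ord -cardsT.
  rewrite -(card_imset _ (_ : injective (fun c => Some (c, root T) : N)));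
    last by move=> a b [].
  apply: eq_card => -[[c' u']|]; last first.
    by rewrite inE /=; apply/esym/imsetP => -[].
  rewrite inE /=; apply/eqP/imsetP.
    case E: (parent u') => [w|] // _; exists c' => //.
    by move/parent_root: E => ->.
  move=> [c _ [_ ->]]; have /parent_root -> // : root T = root T by [].
- move=> i j [c1 /leaf_inj c2]; apply: code_inj.
  by rewrite [LHS]surjective_pairing [RHS]surjective_pairing c1 c2.
- case=> [[c u]|] /=; split=> //; last by case.
    move/level_leaf => [j ->]; have [j' cj] := codeK (c, j).
    by exists j'; rewrite -cj.
  by move=> [j [_ ->]]; apply/level_leaf; exists (code j).2.
Qed.

Definition k_max (h : nat) (k : 'I_h -> nat -> nat) (n : nat) : nat :=
  \max_(i < h) k i n.

(* Main.v *)
(* Every internal node of the tree gets a depth-2 subcircuit computing the AND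
   of its children.  For a prime q dividing m and a power Q of q, the number
   z of false children is divisible by Q iff sum_(j < Q) (-1)^j 'C(z, j) is 1
   modulo q, and it is 0 modulo q otherwise.  Since 'C(z, j) counts the
   j-element sets S of children that are all false, it suffices to express the
   test "S is all false" by MOD_m gates.  Let G be the subgroup of 'Z_m of order
   prime to q and g a nonzero element of G.  As f ranges over the maps from S to
   G, the sum of f over the true elements of S takes the values 0 and g equally
   often unless S is all false, when it always takes the value 0.  So the sum
   over f of [sum = 0] - [sum = g] is #|G|^#|S| or 0, and #|G| is invertible
   modulo q.  The contributions of the primes are added with weights m / q,
   which keeps them independent modulo m.  If the product of the powers Q exceeds
   the number of children, then only z = 0 passes all divisibility tests; powers
   Q of size about the r-th root of that number are enough. *)

Require Import Defs.
From HB Require Import structures.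
From mathcomp Require Import all_boot all_order all_fingroup all_algebra.
From mathcomp Require Import all_classical all_reals all_analysis.
From mathcomp Require Import zify ring.
From mathcomp Require cyclic.
Import Order.TTheory GRing.Theory Num.Theory.
Import numFieldNormedType.Exports.

Set Implicit Arguments.
Unset Strict Implicit.
Unset Printing Implicit Defensive.

(** * Truncated alternating binomial sums *)

(** In i * C(q^e, i) = q^e * C(q^e - 1, i - 1), if [q] did not divide the binomial then q^e would
    divide [i], which is too small. *)
Lemma prime_dvd_bin_pfactor q e i : prime q -> 0 < i < q ^ e ->
  q %| 'C(q ^ e, i).
Proof.
move=> pq /andP[i_gt0 iQ]; apply: contraLR iQ => ndvd; rewrite -leqNgt.
have := mul_bin_diag (q ^ e) i.-1.
rewrite prednK // => E.
apply: dvdn_leq => //.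
rewrite -(@Gauss_dvdl _ _ 'C(q ^ e, i)); last by rewrite coprimeXl // prime_coprime.
by rewrite -E dvdn_mulr.
Qed.

(** Vandermonde's convolution: every term except the first contains some C(q^e, i) with 0 < i < q^e,
    which vanishes modulo [q]. *)
Lemma bin_addn_pfactor q e z j : prime q -> j < q ^ e ->
  'C(q ^ e + z, j) = 'C(z, j) %[mod q].
Proof.
move=> pq jQ; rewrite -binomial.Vandermonde big_ord_recl bin0 mul1n subn0.
rewrite -modnDmr.
suff -> : (\sum_(i < j) 'C(q ^ e, lift ord0 i) * 'C(z, j - lift ord0 i)) %% q = 0.
  by rewrite addn0.
apply/eqP; rewrite -/(dvdn q _); apply: dvdn_sum => i _; apply: dvdn_mulr.
by apply: prime_dvd_bin_pfactor => //=; rewrite (leq_ltn_trans _ jQ) // ltn_ord.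
Qed.

Lemma eqn_modDsum (I : finType) q (F G : I -> nat) (P : pred I) :
  (forall i, P i -> F i = G i %[mod q]) ->
  \sum_(i | P i) F i = \sum_(i | P i) G i %[mod q].
Proof.
move=> FG; elim/big_rec2: _ => // i x y /FG E1 E2.
by rewrite -modnDm E1 E2 modnDm.
Qed.

(** Here [a] is a natural number standing for -1 modulo [q]. Periodicity reduces to z < q^e, where
    the truncation cuts nothing off: the sum is the full expansion of (1 + a)^z, divisible by [q]
    unless z = 0. *)
Lemma truncated_binomial_mod q e a z : prime q -> q %| a.+1 ->
  \sum_(j < q ^ e) 'C(z, j) * a ^ j = (q ^ e %| z) %[mod q].
Proof.
move=> pq qa; have Q_gt0 : 0 < q ^ e by rewrite expn_gt0 prime_gt0.
have [n] := ubnP z; elim: n z => // n IH z zn.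
case: (leqP (q ^ e) z) => zQ.
  rewrite -(subnKC zQ) dvdn_addr // -IH; last first.
    by rewrite ltn_subLR //; lia.
  by apply: eqn_modDsum => j _; rewrite -modnMml bin_addn_pfactor // modnMml.
have -> : \sum_(j < q ^ e) 'C(z, j) * a ^ j = a.+1 ^ z.
  rewrite -addn1 addnC expnDn -!(big_mkord xpredT (fun j => 'C(z, j) * a ^ j)).
  rewrite (@big_cat_nat _ _ _ z.+1) //= [X in _ + X]big1_seq ?addn0.
    by rewrite !big_mkord; apply: eq_bigr => j _; rewrite exp1n mul1n.
  by move=> j; rewrite mem_index_iota => /andP[_ /andP[zj _]]; rewrite bin_small.
case: z zQ {zn} => [|z] zQ; first by rewrite expn0 dvdn0.
by rewrite gtnNdvd // mod0n; apply/eqP; rewrite -/(dvdn _ _) dvdn_exp.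
Qed.

Lemma sum_small_subsets (T : finType) (A : {set T}) Q a :
  \sum_(S : {set T} | (S \subset A) && (#|S| < Q)) a ^ #|S| =
  \sum_(j < Q) 'C(#|A|, j) * a ^ j.
Proof.
case: Q => [|Q].
  by rewrite big_ord0 big_pred0 // => S; rewrite ltn0 andbF.
rewrite (partition_big (fun S : {set T} => inord #|S| : 'I_Q.+1) xpredT) //=.
apply: eq_bigr => j _; rewrite -cards_draws -sum1_card big_distrl /=.
apply: eq_big => [S|S /andP[/andP[_ SQ] /eqP <-]]; last by rewrite inordK // mul1n.
rewrite inE -andbA; congr (_ && _); case: ltnP => SQ /=.
  by apply/eqP/eqP => [<-|E]; [rewrite inordK|apply/val_inj; rewrite /= inordK].
by apply/esym/negbTE/eqP => E; have := ltn_ord j; rewrite -E; lia.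
Qed.

(** Bounding C(|A|, j) by (|A| + 1)^j leaves a geometric sum whose ratio is at least 2, hence below
    its next term. The successor keeps the ratio large when [A] is empty. *)
Lemma sum_small_subsets_le (T : finType) (A : {set T}) Q a : 1 < a ->
  \sum_(S : {set T} | (S \subset A) && (#|S| < Q)) a ^ #|S| <= (#|A|.+1 * a) ^ Q.
Proof.
move=> a1; rewrite sum_small_subsets.
have le : \sum_(j < Q) 'C(#|A|, j) * a ^ j <= \sum_(j < Q) (#|A|.+1 * a) ^ j.
  apply: leq_sum => j _; rewrite expnMn leq_mul2r; apply/orP; right.
  have [jA|Aj] := leqP j #|A|; last by rewrite bin_small.
  rewrite -(leq_pmul2r (fact_gt0 j)) bin_ffact.
  apply: leq_trans (leq_pmulr _ (fact_gt0 j)).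
  have powS i : #|A| ^ i <= #|A|.+1 ^ i by case: i => // i; rewrite leq_exp2r.
  apply: leq_trans (powS j).
  rewrite ffact_prod -[X in _ <= _ ^ X]card_ord -prod_nat_const.
  by apply: leq_prod => i _; apply: leq_subr.
apply: leq_trans le _.
set b := #|A|.+1 * a; have b1 : 1 < b by rewrite /b; nia.
apply: leq_trans (leq_pred (b ^ Q)); rewrite predn_exp leq_pmull //; lia.
Qed.

(** * Testing for falsity by linear forms *)

Section ZeroTest.
Local Open Scope ring_scope.
Variables (m : nat) (T : finType).
Implicit Types (f : {ffun T -> option 'Z_m}) (y : T -> bool) (G : {set 'Z_m}).

(** A map from a subset S to residues is a total function that is [None] off S. A coefficient 0 on S
    thus differs from absence from S, and S can be recovered from [f]. *)
Definition fsupp f : {set T} := [set w | f w != None].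

Definition valued G f : bool := [forall w, if f w is Some a then a \in G else true].

Definition msum f (y : T -> bool) : 'Z_m := \sum_w odflt 0 (f w) *+ y w.

Definition supported G (A : {set T}) : {set {ffun T -> option 'Z_m}} :=
  [set f | (fsupp f == A) && valued G f].

Lemma card_supported G (A : {set T}) : #|supported G A| = (#|G| ^ #|A|)%N.
Proof.
pose F w : pred (option 'Z_m) :=
  if w \in A then [pred o | if o is Some a then a \in G else false] else pred1 None.
have -> : #|supported G A| = #|family F|.
  apply: eq_card => f; rewrite inE; apply/andP/familyP => [[/eqP fA /forallP fG] w|fF].
    have := fG w; rewrite /F -fA inE.
    by case: (f w).
  split.
    apply/eqP/setP => w; rewrite inE; have := fF w; rewrite /F.
    by case: ifP => _; rewrite !inE; [case: (f w)|move=> ->].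
  apply/forallP => w; have := fF w; rewrite /F.
  by case: ifP => _; rewrite !inE; case: (f w).
rewrite card_family foldrE big_map big_enum /=.
rewrite -prod_nat_const [RHS]big_mkcond /=; apply: eq_bigr => w _.
rewrite /F; case: ifP => _; last by rewrite card1.
rewrite -[RHS](card_imset _ (@Some_inj _)); apply: eq_card => o.
rewrite inE; case: o => [a|]; last by apply/esym/imsetP => -[].
by apply/idP/imsetP => [aG|[b bG [->]]] //; exists a.
Qed.

Lemma msum_zero f y (A : {set T}) : fsupp f = A -> (forall w, w \in A -> ~~ y w) ->
  msum f y = 0.
Proof.
move=> fA yA; apply: big1 => w _; case: (boolP (w \in A)) => [/yA/negbTE ->|].
  by rewrite mulr0n.
by rewrite -fA inE negbK => /eqP ->; rewrite mul0rn.
Qed.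

Definition shift (w0 : T) (g : 'Z_m) f : {ffun T -> option 'Z_m} :=
  [ffun w => if w == w0 then omap (+%R g) (f w) else f w].

Lemma shiftK w0 g : cancel (shift w0 g) (shift w0 (- g)).
Proof.
move=> f; apply/ffunP => w; rewrite !ffunE; case: eqP => // _.
by case: (f w) => //= a; rewrite addKr.
Qed.

Lemma fsupp_shift w0 g f : fsupp (shift w0 g f) = fsupp f.
Proof.
apply/setP => w; rewrite !inE ffunE; case: (w == w0) => //.
by case: (f w).
Qed.

Lemma msum_shift w0 g f y : w0 \in fsupp f -> y w0 ->
  msum (shift w0 g f) y = g + msum f y.
Proof.
rewrite inE => fw0 yw0; rewrite /msum (bigD1 w0) // [in RHS](bigD1 w0) //= addrA.
congr (_ + _).
  by rewrite ffunE eqxx yw0 !mulr1n; case: (f w0) fw0.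
by apply: eq_bigr => w /negbTE ww0; rewrite ffunE ww0.
Qed.

Section Subgroup.
Variables (G : {set 'Z_m}) (g : 'Z_m).
Hypotheses (gG : {in G, forall a, g + a \in G}) (gNG : {in G, forall a, - g + a \in G}).
Hypothesis g_neq0 : g != 0.

Lemma valued_shift w0 f : valued G f -> valued G (shift w0 g f).
Proof.
move=> /forallP fG; apply/forallP => w; have := fG w; rewrite ffunE.
by case: eqP => // _; case: (f w) => //= a /gG.
Qed.

Lemma valued_shiftN w0 f : valued G f -> valued G (shift w0 (- g) f).
Proof.
move=> /forallP fG; apply/forallP => w; have := fG w; rewrite ffunE.
by case: eqP => // _; case: (f w) => //= a /gNG.
Qed.

(* Translating one coefficient by [g] matches the solutions of [msum f y = 0]
   with those of [msum f y = g], unless [y] vanishes on all of [A]. *)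
Lemma sum_zero_test (A : {set T}) (y : T -> bool) :
  \sum_(f in supported G A) ((msum f y == 0)%:R - (msum f y == g)%:R) =
  (if [forall w in A, ~~ y w] then (#|G| ^ #|A|)%:R else 0) :> 'Z_m.
Proof.
case: ifP => [/forall_inP yA|/negbT /forall_inPn[w0 w0A]].
  rewrite (eq_bigr (fun=> 1)) => [|f]; last first.
    rewrite inE => /andP[/eqP fA _].
    by rewrite (msum_zero fA yA) eqxx eq_sym (negbTE g_neq0) subr0.
  by rewrite sumr_const card_supported.
rewrite negbK => yw0; rewrite sumrB; apply/eqP; rewrite subr_eq0; apply/eqP.
rewrite [RHS](reindex (shift w0 g)) /=; last first.
  by exists (shift w0 (- g)) => f _; rewrite ?shiftK // -[X in shift w0 X]opprK shiftK.
apply: eq_big => f.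
  rewrite !inE fsupp_shift; congr (_ && _).
  by apply/idP/idP => [/valued_shift ->//|/(valued_shiftN w0)]; rewrite shiftK.
rewrite inE => /andP[/eqP fA _]; rewrite msum_shift ?fA // -{2}[g]addr0.
by rewrite (inj_eq (addrI g)).
Qed.

Definition small_supp Q (A : {set T}) f :=
  [&& fsupp f \subset A, (#|fsupp f| < Q)%N & valued G f].

(** Grouping the maps by support S turns each group into one zero test: it contributes (a * |G|)^|S|
    if S lies in the false part of [A] and 0 otherwise. With a * |G| = -1 modulo q this is the
    truncated alternating sum. *)
Lemma sum_small_supp Q (A : {set T}) (a : nat) (y : T -> bool) :
  \sum_(f | small_supp Q A f)
     (a ^ #|fsupp f|)%:R * ((msum f y == 0)%:R - (msum f y == g)%:R) =
  (\sum_(j < Q) 'C(#|[set w in A | ~~ y w]|, j) * (a * #|G|) ^ j)%:R :> 'Z_m.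
Proof.
rewrite -sum_small_subsets natr_sum.
rewrite (partition_big fsupp (fun S => (S \subset A) && (#|S| < Q)%N)) /=; last first.
  by move=> f /and3P[-> ->].
rewrite [RHS]big_mkcond [LHS]big_mkcond; apply: eq_bigr => S _.
case: (boolP (S \subset A)) => SA /=; last first.
  rewrite ifF //; apply: contraNF SA => /andP[SB _]; apply: fintype.subset_trans SB _.
  by apply/fintype.subsetP => w; rewrite inE => /andP[].
case: (boolP (#|S| < Q)%N) => SQ; last by rewrite andbF.
rewrite andbT.
transitivity ((a ^ #|S|)%:R * \sum_(f in supported G S)
    ((msum f y == 0)%:R - (msum f y == g)%:R) : 'Z_m).
  rewrite big_distrr /=; apply: eq_big => [f|f /andP[_ /eqP ->] //].
  rewrite inE /small_supp andbC; case: eqP => //= ->; by rewrite SA SQ.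
rewrite sum_zero_test expnMn natrM.
have -> : (S \subset [set w in A | ~~ y w]) = [forall w in S, ~~ y w].
  apply/fintype.subsetP/forall_inP => H w wS; have := H w wS; rewrite inE; first by case/andP.
  by rewrite (fintype.subsetP SA _ wS) => ->.
by case: ifP => _ //; rewrite mulr0.
Qed.

End Subgroup.

Lemma card_small_supp G Q (A : {set T}) : (1 < m)%N ->
  (#|[set f | small_supp G Q A f]| <= (#|A|.+1 * m) ^ Q)%N.
Proof.
move=> m_gt1; apply: leq_trans (sum_small_subsets_le A Q m_gt1).
rewrite -sum1dep_card (partition_big fsupp (fun S => (S \subset A) && (#|S| < Q)%N)) /=; last first.
  by move=> f /and3P[-> ->].
apply: leq_sum => S _; apply: leq_trans (_ : #|G| ^ #|S| <= _)%N; last first.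
  case: #|S| => // n; rewrite leq_exp2r // (leq_trans (max_card _)) // card_ord.
  by rewrite Zp_cast.
rewrite -card_supported sum1dep_card subset_leq_card //; apply/fintype.subsetP => f.
by rewrite !inE /small_supp => /andP[/and3P[_ _ ->] ->].
Qed.

End ZeroTest.

(** * Combining the primes dividing the modulus *)

Section PrimeParts.
Local Open Scope ring_scope.
Variable m : nat.
Hypothesis two_primes : (1 < size (primes m))%N.

Lemma modulus_gt1 : (1 < m)%N.
Proof. by case: m two_primes => [|[|]]. Qed.

Let m_gt0 : (0 < m)%N := ltnW modulus_gt1.

(** The group being cyclic, the elements killed by the q'-part of [m] form its subgroup of that
    order, generated by [part_gen q]. *)
Definition coprime_part (q : nat) : {set 'Z_m} := [set a | a *+ m`_q^' == 0].

Definition part_gen (q : nat) : 'Z_m := (m`_q)%:R.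

Lemma coprime_part_add q : {in coprime_part q, forall a, part_gen q + a \in coprime_part q}.
Proof.
move=> a; rewrite !inE mulrnDl => /eqP ->; rewrite addr0 -mulr_natr -natrM partnC //.
by rewrite pchar_Zp // modulus_gt1.
Qed.

Lemma coprime_part_sub q :
  {in coprime_part q, forall a, - part_gen q + a \in coprime_part q}.
Proof.
move=> a; rewrite !inE mulrnDl => /eqP ->; rewrite addr0 mulNrn oppr_eq0.
by rewrite -mulr_natr -natrM partnC // pchar_Zp // modulus_gt1.
Qed.

(** A second prime divides the q'-part of [m]. This is what makes the translation [part_gen q]
    nonzero in 'Z_m. *)
Lemma partn_lt q : q \in primes m -> (m`_q < m)%N.
Proof.
move=> qm; rewrite -[X in (_ < X)%N](partnC q m_gt0) ltn_Pmulr ?part_gt0 //.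
have [p pm pq] : exists2 p, p \in primes m & p != q.
  case E: (primes m) two_primes => [|p1 [|p2 s]] // _.
  have := primes_uniq m; rewrite E /= !inE negb_or => /andP[/andP[p12 _] _].
  case: (eqVneq p1 q) => [<-|p1q]; last by exists p1; rewrite ?mem_head.
  by exists p2; rewrite ?inE ?eqxx ?orbT // eq_sym.
move: pm; rewrite mem_primes => /and3P[pp _ pm].
apply: leq_trans (prime_gt1 pp) _; apply: dvdn_leq; first exact: part_gt0.
have -> : p = (p`_q^')%N by rewrite part_pnat_id // pnatE.
exact: partn_dvd.
Qed.

Lemma part_gen_neq0 q : q \in primes m -> part_gen q != 0.
Proof.
move=> qm; apply/eqP => /(congr1 val) /=; rewrite val_Zp_nat ?modulus_gt1 //.
by rewrite modn_small ?partn_lt // => E; have := part_gt0 q m; rewrite E.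
Qed.

(** The elements are listed explicitly as the multiples of the q-part of [m]. *)
Lemma card_coprime_part q : q \in primes m -> #|coprime_part q| = (m`_q^')%N.
Proof.
move=> qm; rewrite -[RHS]card_ord.
have le_m (c : 'I_(m`_q^')) : (c * m`_q < m)%N.
  by rewrite -[X in (_ < X)%N](partnC q m_gt0) mulnC ltn_pmul2l ?part_gt0.
have h_inj : injective (fun c : 'I_(m`_q^') => (c * m`_q)%:R : 'Z_m).
  move=> c d /(congr1 val) /=; rewrite !val_Zp_nat ?modulus_gt1 //.
  rewrite !modn_small // => /eqP; rewrite eqn_pmul2r ?part_gt0 // => /eqP.
  exact: val_inj.
rewrite -cardsT -(card_imset _ h_inj); apply: eq_card => a; rewrite inE.
apply/eqP/imsetP => [a0|[c _ ->]]; last first.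
  by rewrite -mulrnA -mulnA partnC // natrM pchar_Zp ?mulr0 ?modulus_gt1.
have am : (a < m)%N by rewrite -[X in (_ < X)%N](Zp_cast modulus_gt1).
have /dvdnP[c ac] : (m`_q %| a)%N.
  have : (m %| a * m`_q^')%N.
    rewrite /dvdn -(val_Zp_nat modulus_gt1) natrM natr_Zp mulr_natr a0.
    by [].
  by rewrite -{1}(partnC q m_gt0) dvdn_pmul2r ?part_gt0.
have cl : (c < m`_q^')%N.
  by rewrite -(ltn_pmul2r (part_gt0 q m)) -ac mulnC partnC.
by exists (Ordinal cl) => //=; rewrite -ac natr_Zp.
Qed.

(** A natural number representing -1/|G| modulo [q], for G the coprime part: the power is the
    inverse given by Euler's theorem, and q - 1 stands for -1. *)
Definition neg_inv (q : nat) : nat := ((m`_q^') ^ (totient q).-1 * q.-1)%N.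

Lemma neg_invP q : q \in primes m -> (q %| (neg_inv q * #|coprime_part q|).+1)%N.
Proof.
move=> qm; rewrite card_coprime_part //.
have pq : prime q by move: qm; rewrite mem_primes => /and3P[].
have cop : coprime (m`_q^') q.
  by rewrite coprime_sym prime_coprime // -p'natE // part_pnat.
have q_gt0 := prime_gt0 pq.
have E : (neg_inv q * m`_q^' = q.-1 * m`_q^' ^ totient q)%N.
  rewrite /neg_inv mulnAC -expnSr prednK ?totient_gt0 // mulnC.
  by [].
rewrite E -addn1 /dvdn -modnDml -modnMmr (cyclic.Euler_exp_totient cop) modnMmr muln1 modnDml.
by rewrite addn1 prednK // modnn.
Qed.

Lemma natr_cofactor_mod q a b : (q %| m)%N -> a = b %[mod q] ->
  (m %/ q * a)%:R = (m %/ q * b)%:R :> 'Z_m.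
Proof.
move=> qm ab; rewrite -[LHS]Zp_nat_mod ?modulus_gt1 // -[RHS]Zp_nat_mod ?modulus_gt1 //.
congr (_%:R); rewrite -{2 4}(divnK qm).
by rewrite -!muln_modr ab.
Qed.

Definition cofactor_sum : 'Z_m := \sum_(q < m.+1 | (q : nat) \in primes m) (m %/ q)%:R.

(** The difference of the two sums is the sum of m / p over the failing p. If q fails, the q-part of
    [m] divides m / p for every other p but not m / q, so the difference is nonzero modulo [m]. *)
Lemma cofactor_sum_eq (b : 'I_m.+1 -> bool) :
  (\sum_(q < m.+1 | (q : nat) \in primes m) (m %/ q * b q)%:R == cofactor_sum) =
  [forall q : 'I_m.+1, ((q : nat) \in primes m) ==> b q].
Proof.
apply/eqP/forall_inP => [E q qm|bT]; last first.
  by apply: eq_bigr => q /bT ->; rewrite muln1.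
apply: contraT => nb.
have : \sum_(p < m.+1 | (p : nat) \in primes m) (m %/ p * ~~ b p)%:R = 0 :> 'Z_m.
  apply: (addrI cofactor_sum); rewrite addr0 -{1}E -big_split /=.
  apply: eq_bigr => p _; rewrite -natrD -mulnDr; congr (_%:R).
  by case: (b p); rewrite muln1.
rewrite -natr_sum => /(congr1 val) /=; rewrite val_Zp_nat ?modulus_gt1 // => /eqP.
rewrite -/(dvdn m _) => mdvd.
move: (qm); rewrite mem_primes => /and3P[pq _ qdm].
have pdvd : (m`_q %| m %/ q * ~~ b q)%N.
  move: (dvdn_trans (dvdn_part q m) mdvd); rewrite (bigD1 q) //= dvdn_addl //.
  apply: dvdn_sum => p /andP[pm pq']; apply: dvdn_mulr.
  move: pm; rewrite mem_primes => /and3P[pp _ pdm].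
  rewrite p_part pfactor_dvdn ?divn_gt0 ?(prime_gt0 pp) ?(dvdn_leq _ pdm) //.
  have /eqP lqp : logn q p == 0%N by rewrite logn_prime // eqb0 eq_sym.
  by rewrite logn_div // lqp subn0.
move: pdvd; rewrite nb muln1 p_part pfactor_dvdn ?divn_gt0 ?(prime_gt0 pq) ?(dvdn_leq _ qdm) //.
have lqq : logn q q = 1%N by rewrite logn_prime // eqxx.
rewrite logn_div // lqq.
have : (0 < logn q m)%N by rewrite logn_gt0.
by lia.
Qed.

(** The flag [b] selects the test against 0 with sign + or the test against [part_gen q] with sign
    -. Modulo q, the power of [neg_inv q] turns the count |G|^s into (-1)^s. *)
Definition coef (q : nat) (b : bool) (s : nat) : 'Z_m :=
  (m %/ q * neg_inv q ^ s)%:R * (-1) ^+ ~~ b.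

Definition test_residue (q : nat) (b : bool) : 'Z_m := if b then 0 else part_gen q.

Definition test_sum (T : finType) (Q : nat -> nat) (A : {set T}) (y : T -> bool) : 'Z_m :=
  \sum_(q < m.+1 | (q : nat) \in primes m)
    \sum_(f | small_supp (coprime_part q) (Q q) A f)
      \sum_(b : bool) coef q b #|fsupp f| * (msum f y == test_residue q b)%:R.

(** The part for each prime q collapses to m / q times the indicator that [Q q] divides the number z
    of false elements. All tests passing means that the product of the [Q q] divides z, and z is
    smaller than that product. *)
Lemma test_sum_eq (T : finType) (Q : nat -> nat) (A : {set T}) (y : T -> bool) :
  (forall q, q \in primes m -> exists e, Q q = (q ^ e)%N) ->
  (#|A| < \prod_(q <- primes m) Q q)%N ->
  (test_sum Q A y == cofactor_sum) = [forall w in A, y w].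
Proof.
move=> Qpow AQ; pose z := #|[set w in A | ~~ y w]|.
have -> : test_sum Q A y =
    \sum_(q < m.+1 | (q : nat) \in primes m) (m %/ q * (Q q %| z)%N)%:R.
  apply: eq_bigr => q qm.
  move: (qm); rewrite mem_primes => /and3P[pq _ qdm].
  have [e Qe] := Qpow _ qm.
  rewrite -(natr_cofactor_mod qdm (_ : (\sum_(j < Q q) 'C(z, j) * (neg_inv q * #|coprime_part q|) ^ j)%N
     = _ %[mod q])); last first.
    by rewrite Qe; apply: truncated_binomial_mod => //; apply: neg_invP.
  rewrite natrM -(sum_small_supp (coprime_part_add (q := q)) (coprime_part_sub (q := q)) (part_gen_neq0 qm)).
  rewrite big_distrr; apply: eq_bigr => f _ /=.
  rewrite big_bool /coef /test_residue /= natrM expr0 expr1; ring.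
rewrite (cofactor_sum_eq (fun q => Q q %| z)%N).
apply/forall_inP/forall_inP => [zQ w wA|yA q _]; last first.
  rewrite (_ : z = 0)%N //; apply: eq_card0 => w; rewrite inE.
  by apply/negbTE/negP => /andP[/yA ->].
apply: contraT => yw.
have z_gt0 : (0 < z)%N by apply/card_gt0P; exists w; rewrite inE wA.
have zA : (z <= #|A|)%N by apply: subset_leq_card; apply/fintype.subsetP => u; rewrite inE => /andP[].
(* Powers of distinct primes are coprime, so the individual divisibilities multiply, by induction
   along a duplicate-free list of primes of [m]. *)
have dvd : (\prod_(q <- primes m) Q q %| z)%N.
  have all_dvd q : q \in primes m -> (Q q %| z)%N.
    move=> qm; have := zQ (inord q); rewrite inordK //; first exact.
    by move: qm; rewrite mem_primes ltnS => /and3P[_ _ /dvdn_leq ->].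
  have := primes_uniq m; have : {subset primes m <= primes m} by [].
  elim: {1 3 4}(primes m) => [|p s IH] sub; first by rewrite big_nil dvd1n.
  rewrite big_cons => /= /andP[ps us]; rewrite Gauss_dvd.
    by rewrite all_dvd ?IH ?sub ?mem_head // => q qs; rewrite sub // inE qs orbT.
  rewrite big_seq; apply: (big_ind (fun x => coprime (Q p) x)) => [|x x' cx cx'|q qs].
  - exact: coprimen1.
  - by rewrite coprimeMr cx.
  - have pm := sub p (mem_head p s).
    have qm : q \in primes m by rewrite sub // inE qs orbT.
    have [[e ->] [e' ->]] := (Qpow _ pm, Qpow _ qm).
    apply: coprimeXl; apply: coprimeXr.
    move: pm qm; rewrite !mem_primes => /and3P[pp _ _] /and3P[pq _ _].
    by rewrite prime_coprime // dvdn_prime2 //; apply: contraNneq ps => ->.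
by have := leq_ltn_trans (dvdn_leq z_gt0 dvd) (leq_ltn_trans zA AQ); rewrite ltnn.
Qed.

End PrimeParts.

(** * The circuit of a tree *)

Section TreeCircuit.
Variables (m n h : nat) (k : 'I_h -> nat) (T : level_tree n k) (Q : nat -> nat).
Hypothesis two_primes : (1 < size (primes m))%N.

Definition children (v : T) : {set T} := [set u | parent u == Some v].

Lemma level_children u v : u \in children v -> level v = (level u).+1 :> nat.
Proof. by rewrite inE => /eqP; apply: level_parent. Qed.

Lemma leafNchildren j v : 0 < level v -> leaf T j != v.
Proof.
by apply: contraTneq => <-; rewrite -leqNgt leqn0; apply/eqP/level_leaf; exists j.
Qed.

Lemma card_children_level v : 0 < level v -> exists i, #|children v| = k i.
Proof.
move=> v_gt0; have lh : (level v).-1 < h.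
  by have := ltn_ord (level v); case: (nat_of_ord (level v)) v_gt0.
by exists (Ordinal lh); apply: card_children; rewrite /= prednK.
Qed.

(** A tuple (v, (q, (f, b))): the tree node served, the prime, the linear form on children of v, and
    the choice of residue. Bounding q by [m] keeps the type finite. *)
Local Notation test := (T * ('I_m.+1 * ({ffun T -> option 'Z_m} * bool)))%type.

Definition valid_test (x : test) : bool :=
  [&& 0 < level x.1, (x.2.1 : nat) \in primes m &
      small_supp (coprime_part m x.2.1) (Q x.2.1) (children x.1) x.2.2.1].

Definition test_gate := {x : test | valid_test x}.

Definition tree_gate := (T + test_gate)%type.

Definition tree_label (g : tree_gate) : 'I_n + {set 'Z_m} :=
  match g with
  | inl v => if [pick j | leaf T j == v] is Some j then inl j
             else inr [set cofactor_sum m]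
  | inr x => inr [set test_residue m (val x).2.1 (val x).2.2.2]
  end.

Definition test_coef (x : test) : 'Z_m := coef m x.2.1 x.2.2.2 #|fsupp x.2.2.1|.

(* The summand [m] changes no residue, and makes every wire of the tree present. *)
Definition tree_wires (g g' : tree_gate) : nat :=
  match g, g' with
  | inl v, inr x => if (val x).1 == v then test_coef (val x) + m else 0
  | inr x, inl w => if w \in children (val x).1
                    then odflt 0%R ((val x).2.2.1 w) + m else 0
  | _, _ => 0
  end.

(** Each wire lowers this rank by exactly one, which yields both acyclicity and the exact path
    lengths. Valid tests sit at positive levels, so the predecessor never truncates. *)
Definition tree_rank (g : tree_gate) : nat :=
  match g with inl v => (level v).*2 | inr x => (level (val x).1).*2.-1 end.

Lemma tree_wires_rank g g' : 0 < tree_wires g g' -> tree_rank g = (tree_rank g').+1.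
Proof.
case: g g' => [v|x] [w|y] //=.
  by case: eqP => // <- _; rewrite prednK // double_gt0; case/and3P: (valP y).
by case: ifP => // /level_children ->.
Qed.

Lemma tree_label_input g i : tree_label g = inl i <-> g = inl (leaf T i).
Proof.
split=> [|->] /=; last first.
  case: pickP => [j /eqP /leaf_inj -> //|/(_ i)]; by rewrite eqxx.
by case: g => //= v; case: pickP => // j /eqP <- [->].
Qed.

Lemma tree_wires_input i g : tree_wires (inl (leaf T i)) g = 0.
Proof.
case: g => //= x; case: eqP => // xi; have /and3P[] := valP x.
by rewrite xi (_ : nat_of_ord (level _) = 0) //; apply/level_leaf; exists i.
Qed.

Lemma tree_wires_acyclic g g' : 0 < tree_wires g g' ->
  ~~ connect (fun a b => 0 < tree_wires a b) g' g.
Proof.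
move=> /tree_wires_rank gg'; apply/negP => /connectP[p].
elim: p g' gg' => [|a p IH] g' gg' /=; first by move=> _ E; move: gg'; rewrite E; lia.
move=> /andP[/tree_wires_rank g'a pp] gE.
have {pp gE} : tree_rank g <= tree_rank a.
  elim: p a pp gE {IH g'a} => [|b p IH] a /=; first by move=> _ ->.
  by move=> /andP[/tree_wires_rank -> pp] /(IH _ pp)/leqW.
lia.
Qed.

Definition tree_circuit : circuit m n :=
  @Circuit m n tree_gate tree_label tree_wires (fun i => inl (leaf T i))
    (inl (Defs.root T)) tree_label_input tree_wires_input tree_wires_acyclic.

Local Notation C := tree_circuit.

(** * Path lengths in the circuit *)

Section Depth.
Hypothesis k_gt0 : forall i, 0 < k i.
Hypothesis Q_gt0 : forall q, q \in primes m -> 0 < Q q.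

Let m_gt0 : 0 < m := ltnW (modulus_gt1 two_primes).

Lemma tree_path_to_leaf v : exists p : seq C,
  [/\ path (child (C := C)) (inl v) p, size p = (level v).*2 &
      exists i, last (inl v : C) p = input C i].
Proof.
have [l] := ubnP (level v); elim: l v => // l IH v vl.
have [v0|v_gt0] := posnP (level v).
  exists [::]; rewrite v0; split=> //.
  by have /level_leaf[j ->] : level v = 0 :> nat by []; exists j.
have [i ci] := card_children_level v_gt0.
have /card_gt0P[w wv] : 0 < #|children v| by rewrite ci.
have lw := level_children wv.
have [|p [wp sp [j jp]]] := IH w; first by rewrite lw in vl.
have [q qm] : exists q, q \in primes m.
  by case: (primes m) two_primes => [|q s] // _; exists q; rewrite mem_head.
have qm1 : q < m.+1.
  by move: qm; rewrite mem_primes ltnS => /and3P[_ _ /dvdn_leq ->].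
(* The form with empty support is always a valid test, and the summand [m] still wires it to every
   child. *)
have valx : valid_test (v, (Ordinal qm1, ([ffun=> None], true))).
  have fs0 : fsupp ([ffun=> None] : {ffun T -> option 'Z_m}) = finset.set0.
    by apply/setP => u; rewrite !inE ffunE.
  rewrite /valid_test /= v_gt0 qm /= /small_supp fs0 finset.sub0set cards0 Q_gt0 //=.
  by apply/forallP => u; rewrite ffunE.
exists [:: inr (Sub _ valx), inl w & p]; split.
- by rewrite /= /child /= eqxx addn_gt0 m_gt0 orbT wv addn_gt0 m_gt0 orbT.
- by rewrite /= sp lw.
- by exists j.
Qed.

Lemma tree_circuit_depth : has_depth C (2 * h).
Proof.
have rootE : level (Defs.root T) = h :> nat.
  by have /level_root -> : Defs.root T = Defs.root T by [].
have path_rank (g : C) (p : seq C) : path (child (C := C)) g p ->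
    tree_rank g = tree_rank (last g p) + size p.
  elim: p g => [|a p IH] g /=; first by rewrite addn0.
  by move=> /andP[/tree_wires_rank -> /IH ->]; rewrite addnS.
split; last first.
  move=> p [/path_rank + [i pi]]; rewrite pi /=.
  by rewrite rootE -mul2n => ->; apply: leq_addl.
have [p [rp sp ip]] := tree_path_to_leaf (Defs.root T).
by exists p; rewrite // sp rootE mul2n.
Qed.

End Depth.

(** * Values of the gates *)

Section Correctness.
Hypothesis Qpow : forall q, q \in primes m -> exists e, Q q = q ^ e.
Hypothesis Qprod : forall i, k i < \prod_(q <- primes m) Q q.

Variable x : {ffun 'I_n -> bool}.
Local Notation ev := (Defs.eval (C := C) x).
Let val_node (w : T) : bool := ev (inl w).

Let m_gt1 : 1 < m := modulus_gt1 two_primes.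

Lemma natr_modulus_add a : ((a + m)%:R = a%:R :> 'Z_m)%R.
Proof. by rewrite natrD pchar_Zp // addr0. Qed.

Lemma eval_leaf i : ev (inl (leaf T i)) = x i.
Proof.
by rewrite evalE /gate_value; have /(_ C (inl (leaf T i)) i)[_ /(_ erefl) ->] := @label_input m n.
Qed.

Lemma eval_test (y : test_gate) :
  ev (inr y) = (msum (val y).2.2.1 val_node == test_residue m (val y).2.1 (val y).2.2.2).
Proof.
rewrite evalE /gate_value /= /MOD_gate inE; congr (_ == _).
rewrite big_sumType /= [X in _ + X]big1 // addn0 natr_sum.
have /and3P[_ _ /and3P[/fintype.subsetP sf _ _]] := valP y.
apply: eq_bigr => w _; case: ifP => [wv|wv].
  by rewrite natrM natr_modulus_add natr_Zp mulr_natr.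
(* No wire leads to a node that is not a child; the support condition forces [None] there, so [msum]
   has no contribution either. *)
case E: ((val y).2.2.1 w) => [a|]; last by rewrite /= mul0rn.
by move: (sf w); rewrite wv inE E => /(_ isT).
Qed.

Lemma eval_internal v : 0 < level v ->
  ev (inl v) = [forall w in children v, val_node w].
Proof.
move=> v_gt0; rewrite evalE /gate_value /=.
case: pickP => [j /eqP jv|_]; first by have := leafNchildren j v_gt0; rewrite jv eqxx.
rewrite /MOD_gate inE -(test_sum_eq (A := children v) two_primes val_node Qpow); last first.
  by have [i ->] := card_children_level v_gt0.
congr (_ == _).
have -> : \sum_(g' : C) wires (inl v : C) g' * ev g' =
    \sum_(y : test_gate) tree_wires (inl v) (inr y) * ev (inr y).
  by rewrite big_sumType /= [X in X + _]big1.
rewrite natr_sum.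
pose F (p : test) : 'Z_m :=
  (test_coef p * (msum p.2.2.1 val_node == test_residue m p.2.1 p.2.2.2)%:R)%R.
transitivity (\sum_(y : test_gate | (val y).1 == v) F (val y))%R.
  rewrite [RHS]big_mkcond; apply: eq_bigr => y _; rewrite /tree_wires.
  case: ifP => // _; rewrite natrM natr_modulus_add natr_Zp eval_test.
  by [].
(* The sum over the subtype of valid tests is moved to plain tuples, then its node is fixed to [v],
   leaving the nested sum over q, f and b of [test_sum]. *)
transitivity (\sum_(p in valid_test | p.1 == v) F p)%R.
  by rewrite big_sub_cond.
pose P2 (p : 'I_m.+1 * ({ffun T -> option 'Z_m} * bool)) := valid_test (v, p).
transitivity (\sum_(p | P2 p) F (v, p))%R.
  transitivity (\sum_(u | u == v) \sum_(p | P2 p) F (u, p))%R; last by rewrite big_pred1_eq.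
  rewrite pair_big_dep; apply: eq_big => [[u p]|[u p] //] /=.
  by rewrite unfold_in andbC /P2; case: eqP => // ->.
rewrite /test_sum; under [RHS]eq_bigr => q _ do rewrite pair_big_dep.
rewrite pair_big_dep /=.
apply: eq_big => [[q [f b]]|[q [f b]] _] /=.
  by rewrite /P2 /valid_test /= v_gt0 andbT.
by [].
Qed.

Lemma eval_root : ev (inl (Defs.root T)) = [forall i, x i].
Proof.
apply/idP/forallP => [rootT|xT].
  suff nodeT v : val_node v by move=> i; rewrite -eval_leaf; apply: nodeT.
  (* Truth spreads from the root downwards, by induction on the distance to the root; the converse
     climbs from the leaves by induction on the level. *)
  have [l] := ubnP (h - level v); elim: l v => // l IH v vl.
  case E: (parent v) => [u|]; last by move/parent_root: E => ->.
  have uv := level_parent E; have := ltn_ord (level u); rewrite ltnS uv => vh.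
  have /IH : h - level u < l by rewrite uv; lia.
  rewrite /val_node eval_internal ?uv // => /forall_inP; apply.
  by rewrite inE E.
suff nodeT v : val_node v by apply: nodeT.
have [l] := ubnP (level v); elim: l v => // l IH v vl.
have [v0|v_gt0] := posnP (level v).
  by have /level_leaf[j ->] : level v = 0 :> nat by []; rewrite /val_node eval_leaf.
rewrite /val_node eval_internal //; apply/forall_inP => w /level_children vw.
by apply: IH; move: vl; rewrite vw.
Qed.

End Correctness.

(** * Action of tree automorphisms on the gates *)

Section Symmetry.
Variable t : {perm T}.
Hypothesis t_aut : tree_aut t.

Let parent_aut u : parent (t u) = omap t (parent u).
Proof. by apply/eqP; move/forallP: t_aut. Qed.

Lemma aut_root : t (Defs.root T) = Defs.root T.
Proof.
apply/parent_root; rewrite parent_aut (_ : parent (Defs.root T) = None) //.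
exact/parent_root.
Qed.

(** [tree_aut] constrains parents only; the level is recovered from the distance to the root, which
    is fixed. *)
Lemma aut_level v : level (t v) = level v.
Proof.
have [l] := ubnP (h - level v); elim: l v => // l IH v vl.
case E: (parent v) => [u|]; last by move/parent_root: E => ->; rewrite aut_root.
have uv := level_parent E; have := ltn_ord (level u); rewrite ltnS uv => vh.
have /IH tu : h - level u < l by rewrite uv; lia.
have := parent_aut v; rewrite E => /level_parent.
by rewrite tu uv => -[] /val_inj.
Qed.

Lemma aut_children u v : (t u \in children (t v)) = (u \in children v).
Proof.
rewrite !inE parent_aut; case: (parent u) => //= w.
by rewrite !(inj_eq Some_inj) (inj_eq perm_inj).
Qed.

Definition test_act (x : test) : test :=
  (t x.1, (x.2.1, ([ffun w => x.2.2.1 ((t^-1)%g w)], x.2.2.2))).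

Lemma test_act_inj : injective test_act.
Proof.
move=> [v [q [f b]]] [v' [q' [f' b']]] [/perm_inj -> -> fE ->].
congr (_, (_, (_, _))); apply/ffunP => w.
by move/ffunP: fE => /(_ (t w)); rewrite !ffunE permK.
Qed.

Lemma fsupp_test_act x : fsupp (test_act x).2.2.1 = t @: fsupp x.2.2.1.
Proof.
apply/setP => w; rewrite inE ffunE -[in RHS](permKV t w) mem_imset ?inE //.
exact: perm_inj.
Qed.

(** Validity depends on the level, the prime, and the location, size and values of the form, all
    compatible with moving it along [t]. Each node carries all its valid tests, so [t] permutes the
    test gates. *)
Lemma valid_test_act x : valid_test x -> valid_test (test_act x).
Proof.
move=> /and3P[v_gt0 qm /and3P[sf cf vf]]; apply/and3P; split=> //=.
  by rewrite aut_level.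
have fE := fsupp_test_act x; rewrite /= in fE.
rewrite /small_supp fE card_imset; last exact: perm_inj.
rewrite cf /=; apply/andP; split.
  apply/fintype.subsetP => w /imsetP[u uf ->]; rewrite aut_children.
  exact: (fintype.subsetP sf).
by apply/forallP => w; rewrite ffunE; apply: (forallP vf).
Qed.

Definition gate_act (g : tree_gate) : tree_gate :=
  match g with
  | inl v => inl (t v)
  | inr x => inr (Sub (test_act (val x)) (valid_test_act (valP x)))
  end.

Lemma gate_act_inj : injective gate_act.
Proof.
case=> [v|x] [w|y] //=; first by move=> [/perm_inj ->].
move=> E; congr inr; apply/val_inj/test_act_inj.
exact: (congr1 (fun g : tree_gate => if g is inr z then val z else val x) E).
Qed.

Lemma gate_act_extends (s : 'S_n) : (forall j, t (leaf T j) = leaf T (s j)) ->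
  circuit_aut_extends s (perm gate_act_inj : {perm C}).
Proof.
move=> tleaf; split=> [g|g g'|]; rewrite ?permE //=; last by rewrite aut_root.
  case: g => [v|x] //=.
  case: (pickP (fun j => leaf T j == v)) => [j /eqP <-|nleaf]; first by rewrite tleaf; exact: (proj2 (tree_label_input (inl (leaf T (s j))) (s j)) erefl).
  (* If [t v] were leaf j, then v would already be the leaf of index s^-1 j. *)
  case: pickP => // j /eqP jv; have := nleaf ((s^-1)%g j).
  by rewrite -(inj_eq (@perm_inj _ t)) tleaf permKV jv eqxx.
case: g g' => [v|x] [w|y] //=.
  rewrite (inj_eq perm_inj) /test_coef fsupp_test_act card_imset //.
  exact: perm_inj.
by rewrite aut_children ffunE permK.
Qed.

End Symmetry.

Lemma tree_circuit_symmetric : symmetric_circuit C (Aut_leaves T).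
Proof.
move=> s; rewrite inE => /existsP[t /andP[t_aut /forallP tleaf]].
by exists (perm (gate_act_inj (t_aut := t_aut))); apply: gate_act_extends => j; apply/eqP.
Qed.

(** * Counting gates and wires *)

Section Size.
Variables K D : nat.
Hypothesis K_gt0 : 0 < K.
Hypothesis kK : forall i, k i <= K.
Hypothesis QD : forall q, q \in primes m -> Q q <= D.

Let m_gt1 : 1 < m := modulus_gt1 two_primes.

Lemma card_level d : d <= h -> #|[set v : T | level v == h - d :> nat]| <= K ^ d.
Proof.
elim: d => [_|d IH dh].
  rewrite subn0 expn0 -(cards1 (Defs.root T)) subset_leq_card //; apply/fintype.subsetP => v.
  rewrite !inE => /eqP vh; apply/eqP/level_root; exact: val_inj.
rewrite expnSr; apply: leq_trans (leq_mul (IH (ltnW dh)) (leqnn K)).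
(* Nodes are grouped by parent. The default [v] never occurs, since a node below the top level is
   not the root. *)
rewrite -sum1_card (partition_big (fun v => odflt v (parent v))
  [in [set v : T | level v == h - d :> nat]]) /=; last first.
  move=> v; rewrite !inE => /eqP vl; case E: (parent v) => [u|] /=.
    by rewrite (level_parent E) vl; apply/eqP; lia.
  move/parent_root: E => vE; have /(congr1 val) /= := (level_root v).2 vE; lia.
rewrite -sum_nat_const; apply: leq_sum => u; rewrite inE => /eqP ul.
have u_gt0 : 0 < level u by rewrite ul; lia.
have [i ci] := card_children_level u_gt0.
apply: leq_trans (kK i); rewrite -ci sum1dep_card subset_leq_card //.
apply/fintype.subsetP => v; rewrite !inE => /andP[/eqP vl].
case E: (parent v) => [w|] /= /eqP; first by move=> ->.
by move=> vu; move: ul; rewrite -vu vl; lia.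
Qed.

Lemma card_tree : #|T| <= h.+1 * K ^ h.
Proof.
rewrite -cardsT -sum1_card (partition_big (@level _ _ _ T) xpredT) //=.
rewrite -[X in X * _]card_ord -sum_nat_const; apply: leq_sum => l _.
rewrite sum1dep_card.
have lh : l <= h by rewrite -ltnS.
apply: leq_trans (_ : K ^ (h - l) <= _); last by rewrite leq_pexp2l // leq_subr.
apply: leq_trans (card_level (leq_subr l h)); rewrite subset_leq_card //.
by apply/fintype.subsetP => v; rewrite !inE subKn.
Qed.

Lemma card_test_gate : #|{: test_gate}| <= #|T| * (m.+1 * ((K.+1 * m) ^ D * 2)).
Proof.
rewrite card_sig -sum1_card.
pose S q v := [set f | small_supp (coprime_part m q) (Q q) (children v) f].
apply: leq_trans (_ : \sum_v \sum_(q < m.+1 | (q : nat) \in primes m)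
    \sum_(f in S q v) \sum_(b : bool) 1 <= _).
  rewrite (eq_bigr (fun v => \sum_(p : 'I_m.+1 * ({ffun T -> option 'Z_m} * bool) |
      ((p.1 : nat) \in primes m) && (p.2.1 \in S p.1 v)) 1)) => [|v _]; last first.
    under eq_bigr => q _ do rewrite pair_big_dep.
    by rewrite pair_big_dep; apply: eq_bigl => p; rewrite andbT.
  rewrite pair_big_dep /= big_mkcond [X in _ <= X]big_mkcond; apply: leq_sum => x _.
  rewrite inE; case: ifP => // /and3P[_ qm sx].
  by rewrite qm inE sx.
rewrite -sum_nat_const; apply: leq_sum => v _.
rewrite -[X in X * _]card_ord -sum_nat_const big_mkcond; apply: leq_sum => q _.
case: ifP => // qm.
rewrite (eq_bigr (fun=> 2)) => [|f _]; last by rewrite sum1_card card_bool.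
rewrite sum_nat_const leq_mul2r /=; apply: leq_trans (card_small_supp _ _ _ m_gt1) _.
apply: leq_trans (_ : (K.+1 * m) ^ Q q <= _); last by rewrite leq_pexp2l ?QD // muln_gt0; lia.
have chK : #|children v| <= K.
  have [v0|v_gt0] := posnP (level v); last by have [i ->] := card_children_level v_gt0.
  suff -> : children v = finset.set0 by rewrite cards0.
  apply/setP => w; rewrite [RHS]inE; apply/negP => /level_children.
  by rewrite v0.
case: (Q q) => // d; by rewrite leq_exp2r // leq_mul2r ltnS chK orbT.
Qed.

Definition gate_bound := h.+1 * K ^ h * (m.+1 * ((K.+1 * m) ^ D * 2)).+1.

Lemma tree_circuit_size : circuit_size C <= gate_bound + gate_bound ^ 2 * (2 * m).
Proof.
have cardC : #|C| <= gate_bound.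
  rewrite card_sum; apply: leq_trans (leq_add (leqnn _) card_test_gate) _.
  by rewrite -mulnS /gate_bound leq_mul2r card_tree orbT.
apply: leq_add => //.
have wires_le (g g' : C) : wires g g' <= 2 * m.
  have Zm (a : 'Z_m) : a + m <= 2 * m.
    by rewrite mul2n -addnn leq_add2r -[X in _ <= X](Zp_cast m_gt1) ltnW.
  case: g g' => [v|x] [w|y] //=; case: ifP => // _.
  exact: (Zm (test_coef (val y))).
apply: leq_trans (_ : #|C| * (#|C| * (2 * m)) <= _).
  rewrite -sum_nat_const; apply: leq_sum => g _.
  by rewrite -sum_nat_const; apply: leq_sum => g' _.
by rewrite mulnA leq_mul2r -mulnn leq_mul ?orbT.
Qed.

End Size.

End TreeCircuit.

(** * Choice of parameters *)

(** For K > 0 this is the least power of the prime [q] whose r-th power exceeds [K], so it lies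
    between K^(1/r) and q * K^(1/r). *)
Definition prime_pow (r K q : nat) : nat := q ^ (trunc_log (q ^ r) K).+1.

Section PrimePowers.
Variables (m r K : nat).
Hypothesis r_gt0 : 0 < r.
Hypothesis K_gt0 : 0 < K.

Lemma prime_pow_bounds q : q \in primes m ->
  K < prime_pow r K q ^ r <= m ^ r * K.
Proof.
rewrite mem_primes => /and3P[pq m_gt0 qm].
have qr_gt1 : 1 < q ^ r by rewrite -(exp1n r) ltn_exp2r // prime_gt1.
rewrite /prime_pow -expnM mulnC expnM trunc_log_ltn //= expnS leq_mul //.
  by rewrite leq_exp2r // dvdn_leq.
exact: trunc_logP.
Qed.

Lemma max_prime_pow_bound : (\max_(q <- primes m) prime_pow r K q) ^ r <= m ^ r * K.
Proof.
rewrite big_seq; apply: (big_ind (fun x => x ^ r <= m ^ r * K)) => [|x y|q].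
- by rewrite exp0n.
- by rewrite /maxn; case: ifP.
- by move/prime_pow_bounds => /andP[].
Qed.

Lemma leq_max_prime_pow q : q \in primes m ->
  prime_pow r K q <= \max_(p <- primes m) prime_pow r K p.
Proof. by move=> qm; exact: (leq_bigmax_seq q qm). Qed.

(** Comparing r-th powers avoids roots: each of the r factors then contributes at least K + 1. *)
Lemma prod_prime_pow_gt : size (primes m) = r ->
  K < \prod_(q <- primes m) prime_pow r K q.
Proof.
move=> mr; rewrite -(ltn_exp2r _ _ r_gt0).
have -> : (\prod_(q <- primes m) prime_pow r K q) ^ r =
    \prod_(q <- primes m) prime_pow r K q ^ r.
  by elim/big_rec2: _ => [|q x y _ <-]; rewrite ?exp1n // expnMn.
apply: leq_trans (_ : \prod_(q <- primes m) K.+1 <= _).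
  by rewrite big_const_seq count_predT mr iter_muln_1 ltn_exp2r.
by rewrite big_seq [X in _ <= X]big_seq; apply: leq_prod => q /prime_pow_bounds /andP[].
Qed.

End PrimePowers.

(** * From the gate count to the exponential bound *)

Lemma gate_bound_le m h K D : 0 < m -> 1 < K -> 0 < D ->
  gate_bound m h K D + gate_bound m h K D ^ 2 * (2 * m) <=
  K ^ ((4 * h + 6 * m + 13) * D).
Proof.
move=> m_gt0 K_gt1 D_gt0.
have K_gt0 : 0 < K by apply: ltnW.
have self_le c : c <= K ^ c by rewrite ltnW // ltn_expl.
have bound1 : (K.+1 * m) ^ D <= K ^ ((m + 2) * D).
  rewrite expnM leq_exp2r // addnC expnD leq_mul //; nia.
have bound2 : (m.+1 * ((K.+1 * m) ^ D * 2)).+1 <= K ^ (m + 3 + (m + 2) * D).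
  have : m.+1 * ((K.+1 * m) ^ D * 2) <= K ^ (m.+1 + ((m + 2) * D + 1)).
    by rewrite !expnD expn1 !leq_mul.
  rewrite (_ : m + 3 + (m + 2) * D = (m.+1 + ((m + 2) * D + 1)).+1); last lia.
  rewrite expnS; set a := _ * _; set b := K ^ _ => ab.
  have : 0 < b by rewrite expn_gt0 K_gt0.
  by nia.
have bound3 : gate_bound m h K D <= K ^ ((2 * h + 2 * m + 6) * D).
  apply: leq_trans (_ : K ^ (h.+1 + h + (m + 3 + (m + 2) * D)) <= _).
    by rewrite !expnD !leq_mul // -?expnD.
  by rewrite leq_pexp2l //; nia.
have B_gt0 : 0 < gate_bound m h K D.
  by rewrite /gate_bound !muln_gt0 expn_gt0 K_gt0.
apply: leq_trans (_ : gate_bound m h K D ^ 2 * (2 * m + 1) <= _).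
  by rewrite mulnDr muln1 addnC leq_add2l -mulnn leq_pmulr.
(* Squaring doubles 2h + 2m + 6, and the factor 2m + 1 is at most K^(2m + 1); as D > 0, the
   exponents add up to at most (4h + 6m + 13) * D. *)
apply: leq_trans (leq_mul (_ : _ <= K ^ (2 * ((2 * h + 2 * m + 6) * D))) (self_le _)) _.
  by rewrite mulnC expnM leq_exp2r.
by rewrite -expnD leq_pexp2l //; nia.
Qed.

Local Open Scope ring_scope.

(** Taking r-th roots gives D <= m * K^(1/r); dividing by ln 2 changes the base of the exponential
    from e to 2. *)
Lemma natr_expn_le_powR2 (R : realType) (m r K D A : nat) : (0 < r)%N -> (0 < K)%N ->
  (D ^ r <= m ^ r * K)%N ->
  (K ^ (A * D))%:R <=
  (2 : R) `^ ((A * m)%:R / ln 2 * (K%:R `^ r%:R^-1 * ln K%:R)).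
Proof.
move=> r_gt0 K_gt0 Dr.
have ln2 : 0 < ln 2 :> R by rewrite ln_gt0 // ltr1n.
have D_le : D%:R <= m%:R * K%:R `^ r%:R^-1 :> R.
  have root (a : R) : 0 <= a -> a = (a ^+ r) `^ r%:R^-1.
    move=> a0; rewrite -powR_mulrn // -powRrM mulfV ?powRr1 //.
    by rewrite pnatr_eq0 -lt0n.
  have mr0 : 0 <= m%:R ^+ r :> R by rewrite exprn_ge0.
  rewrite (root D%:R) // (root m%:R) // -powRM //.
  apply: ge0_ler_powR; rewrite ?nnegrE ?invr_ge0 ?mulr_ge0 ?exprn_ge0 //.
  by rewrite -!natrX -natrM ler_nat.
rewrite /powR pnatr_eq0 /= -/(powR _ _).
have -> : (K ^ (A * D))%:R = expR ((A * D)%:R * ln K%:R) :> R.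
  by rewrite expRM_natl lnK ?natrX // posrE ltr0n.
rewrite ler_expR mulrAC divfK; last by rewrite gt_eqF.
rewrite !natrM -!mulrA ler_wpM2l // !mulrA ler_wpM2r //.
by rewrite ln_ge0 // ler1n.
Qed.

(** * Assembling the circuit family *)

Local Open Scope classical_set_scope.
Local Open Scope ring_scope.

Theorem theorem5p5 (R : realType) (m r : nat) (hr : size (primes m) = r)
    (r_ge2 : (2 <= r)%N) (h : nat) (k : 'I_h -> nat -> nat)
    (prod_k : forall n, (0 < n)%N -> (\prod_(i < h) k i n)%N = n) :
  exists e : nat -> R,
    e =O_\oo (fun n => (k_max k n)%:R `^ (r%:R^-1) * ln ((k_max k n)%:R : R)) /\
    forall n, (0 < n)%N ->
    forall T : level_tree n (fun i => k i n),
    exists C : circuit m n,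
      [/\ symmetric_circuit C (Aut_leaves T),
          has_depth C (2 * h),
          (circuit_size C)%:R <= 2 `^ e n &
          computes C (@AND_fun n)].
Proof.
have two_primes : (1 < size (primes m))%N by rewrite hr.
have m_gt0 : (0 < m)%N by apply: ltnW; apply: modulus_gt1.
have r_gt0 : (0 < r)%N by apply: ltnW.
(* The maximum with 2 keeps the base of the size bound above 1 even at n = 1; it does not affect the
   asymptotics. *)
pose K n := maxn (k_max k n) 2.
pose A := (4 * h + 6 * m + 13)%N.
have A_gt0 : (0 < A)%N by rewrite /A addn_gt0 orbT.
exists (fun n => (A * m)%:R / ln 2 * ((K n)%:R `^ r%:R^-1 * ln (K n)%:R)); split.
  apply/eqO_exP.
  exists ((A * m)%:R / ln 2); first by rewrite divr_gt0 ?ltr0n ?muln_gt0 ?A_gt0 ?ln_gt0 ?ltr1n.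
  near=> n.
  have n2 : (2 <= n)%N by near: n; exact: nbhs_infty_ge.
  have n_gt0 : (0 < n)%N := ltnW n2.
  (* If every branching number were at most 1, their product n would be too. *)
  have -> : K n = k_max k n.
    apply/maxn_idPl; rewrite leqNgt; apply: contraL n2 => kn.
    rewrite -ltnNge ltnS -(prod_k n n_gt0).
    apply: (big_ind (fun x => x <= 1)%N) => // [x y x1 y1|i _]; first exact: leq_mul x1 y1.
    by rewrite -ltnS (leq_ltn_trans _ kn) // /k_max (leq_bigmax i).
  by rewrite normrM ger0_norm // divr_ge0 // ln_ge0 // ler1n.
move=> n n_gt0 T; pose Q := prime_pow r (K n).
pose D := (\max_(q <- primes m) Q q)%N.
have K_gt1 : (1 < K n)%N by rewrite leq_max orbT.
have K_gt0 := ltnW K_gt1.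
have kK i : (k i n <= K n)%N by rewrite leq_max /k_max (leq_bigmax i).
have k_gt0 i : (0 < k i n)%N.
  by have := n_gt0; rewrite -{1}(prod_k n n_gt0) (bigD1 i) //= muln_gt0 => /andP[].
have Q_gt0 q : q \in primes m -> (0 < Q q)%N.
  by rewrite mem_primes expn_gt0 => /and3P[/prime_gt0 ->].
have D_gt0 : (0 < D)%N.
  have [q qm] : exists q, q \in primes m.
    by case: (primes m) two_primes => [|q s] // _; exists q; rewrite mem_head.
  exact: leq_trans (Q_gt0 q qm) (leq_max_prime_pow r (K n) qm).
exists (tree_circuit T Q two_primes); split.
- exact: tree_circuit_symmetric.
- exact: tree_circuit_depth.
- apply: le_trans (natr_expn_le_powR2 R A r_gt0 K_gt0 (max_prime_pow_bound m r_gt0 K_gt0)).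
  rewrite ler_nat.
  apply: leq_trans (gate_bound_le h m_gt0 K_gt1 D_gt0).
  by apply: tree_circuit_size => // q qm; apply: leq_max_prime_pow.
- move=> x; apply: eval_root => [q _|i]; first by exists (trunc_log (q ^ r) (K n)).+1.
  by apply: leq_ltn_trans (kK i) (prod_prime_pow_gt r_gt0 K_gt0 hr).
Unshelve. all: by end_near.
Qed.
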